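(* Let $G=(V,E)$ be a locally finite, connected graph with symmetric edge weights and a uniformly positive measure $\mu$. Let $\alpha,\beta>1$ and let $a,b:V\to\mathbb{R}$ satisfy conditions $(A_1)$ and $(A_2)$. Then for every $\lambda>0$ the system $$-\Delta u+(\lambda a(x)+1)u=\tfrac{\alpha}{\alpha+\beta}|u|^{\alpha-2}u|v|^{\beta},\qquad -\Delta v+(\lambda b(x)+1)v=\tfrac{\beta}{\alpha+\beta}|u|^{\alpha}|v|^{\beta-2}v\quad\text{in }V$$ has a ground state solution $(u_\lambda,v_\lambda)\in H_\lambda$, i.e. a weak solution with $(u_\lambda,v_\lambda)\in\mathcal N_\lambda$ and $J_\lambda(u_\lambda,v_\lambda)=c_{\mathcal N_\lambda}$.
   Context: $G=(V,E)$: $w_{xy}=w_{yx}>0$ for each edge $xy\in E$ (write $y\sim x$); $\mu:V\to(0,\infty)$ with $\mu(x)\ge\mu_{\min}>0$ for all $x$. For $u:V\to\mathbb{R}$: $\Delta u(x)=\frac1{\mu(x)}\sum_{y\sim x}w_{xy}(u(y)-u(x))$, $\Gamma(u,v)(x)=\frac1{2\mu(x)}\sum_{y\sim x}w_{xy}(u(y)-u(x))(v(y)-v(x))$, $|\nabla u|^2=\Gamma(u,u)$, $\int_V f\,d\mu=\sum_{x\in V}\mu(x)f(x)$. $d(x,y)$ is the graph distance; a set is a bounded domain if distances between its points are uniformly bounded. $W^{1,2}(V)=\{u:\int_V(|\nabla u|^2+u^2)d\mu<\infty\}$, $H=W^{1,2}(V)\times W^{1,2}(V)$ with $\|(u,v)\|_H^2=\int_V(|\nabla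 u|^2+|\nabla v|^2+u^2+v^2)d\mu$. $(A_1)$: $a\ge0$, $b\ge0$ on $V$, and $\Omega_a=\{a=0\}$, $\Omega_b=\{b=0\}$ and $\Omega_a\cap\Omega_b$ are non-empty bounded domains. $(A_2)$: there is $x_0\in V$ with $a(x)\to+\infty$ and $b(x)\to+\infty$ as $d(x,x_0)\to\infty$. For $\lambda>0$: $H_\lambda=\{(u,v)\in H:\int_V(\lambda a u^2+\lambda b v^2)d\mu<\infty\}$ with inner product $\langle(u,v),(\xi,\eta)\rangle_{H_\lambda}=\int_V(\Gamma(u,\xi)+(\lambda a+1)u\xi+\Gamma(v,\eta)+(\lambda b+1)v\eta)d\mu$ and norm $\|\cdot\|_{H_\lambda}$. $J_\lambda(u,v)=\frac12\|(u,v)\|_{H_\lambda}^2-\frac1{\alpha+\beta}\int_V|u|^\alpha|v|^\beta d\mu$. A weak solution is $(u,v)\in H_\lambda$ with $\int_V(\Gamma(u,\xi)+\Gamma(v,\eta)+(\lambda a+1)u\xi+(\lambda b+1)v\eta)d\mu=\int_V(\frac{\alpha}{\alpha+\beta}|u|^{\alpha-2}u|v|^\beta\xi+\frac{\beta}{\alpha+\beta}|u|^\alpha|v|^{\beta-2}v\eta)d\mu$ for all $(\xi,\eta)\in H_\lambda$ (i.e. $J_\lambda'(u,v)=0$). Nehari manifold $\mathcal N_\lambda=\{(u,v)\in H_\lambda\setminus\{(0,0)\}:\langle J_\lambda'(u,v),(u,v)\rangle=0\}$, $c_{\mathcal N_\lambda}=\inf_{\mathcal N_\lambda}J_\lambda$.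 *)

(* Defs.v *)
From HB Require Import structures.
From mathcomp Require Import all_boot all_order all_algebra.
From mathcomp Require Import all_classical all_reals all_analysis.
Set Implicit Arguments. Unset Strict Implicit. Unset Printing Implicit Defensive.
Import Order.TTheory GRing.Theory Num.Theory.
Local Open Scope classical_set_scope.
Local Open Scope ring_scope.

Section GraphDefs.
Variables (R : realType) (V : choiceType).
Variable (w : V -> V -> R).

(* y ~ x  iff  w x y > 0 (non-edges carry weight 0) *)
Definition nbrs (x : V) : set V := [set y | 0 < w x y].

Definition locally_finite : Prop := forall x, finite_set (nbrs x).

Inductive walk : nat -> V -> V -> Prop :=
| walk0 x : walk 0 x x
| walkS n x y z : walk n x y -> 0 < w y z -> walk n.+1 x z.

Definition connected_graph : Prop := forall x y, exists n, walk n x y.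

Definition dist_le (x y : V) (n : nat) : Prop := exists2 m, (m <= n)%N & walk m x y.

Definition bounded_domain (A : set V) : Prop :=
  A !=set0 /\ exists D : nat, forall x y, A x -> A y -> dist_le x y D.

Definition A1 (a b : V -> R) : Prop :=
  (forall x, 0 <= a x) /\ (forall x, 0 <= b x) /\
  bounded_domain [set x | a x = 0] /\ bounded_domain [set x | b x = 0] /\
  bounded_domain ([set x | a x = 0] `&` [set x | b x = 0]).

Definition A2 (a b : V -> R) : Prop :=
  exists x0 : V, forall M : R, exists N : nat, forall x,
    ~ dist_le x x0 N -> M <= a x /\ M <= b x.

Variable (mu : V -> R).

Definition Gam (u v : V -> R) (x : V) : R :=
  (2 * mu x)^-1 * \sum_(y \in nbrs x) w x y * (u y - u x) * (v y - v x).

Definition nnint (f : V -> R) : \bar R := (\esum_(x in [set: V]) (mu x * f x)%:E)%E.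

(* integral of a signed (absolutely summable) function *)
Definition intV (f : V -> R) : R :=
  fine (\esum_(x in [set: V]) (Num.max (mu x * f x) 0)%:E
        - \esum_(x in [set: V]) (Num.max (- (mu x * f x)) 0)%:E)%E.

Definition inW12 (u : V -> R) : Prop :=
  (nnint (fun x => Gam u u x + u x ^+ 2)%R < +oo)%E.

Variables (a b : V -> R) (lambda alpha beta : R).

Definition inHlam (u v : V -> R) : Prop :=
  inW12 u /\ inW12 v /\
  (nnint (fun x => lambda * a x * u x ^+ 2 + lambda * b x * v x ^+ 2)%R < +oo)%E.

Definition ipHlam (u v xi eta : V -> R) : R :=
  intV (fun x => Gam u xi x + (lambda * a x + 1) * u x * xi x
               + Gam v eta x + (lambda * b x + 1) * v x * eta x).

Definition Jlam (u v : V -> R) : R :=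
  ipHlam u v u v / 2
  - (alpha + beta)^-1 * intV (fun x => `|u x| `^ alpha * `|v x| `^ beta).

Definition dJlam (u v xi eta : V -> R) : R :=
  ipHlam u v xi eta
  - intV (fun x => alpha / (alpha + beta) * `|u x| `^ (alpha - 2) * u x * `|v x| `^ beta * xi x
                 + beta / (alpha + beta) * `|u x| `^ alpha * `|v x| `^ (beta - 2) * v x * eta x).

Definition weak_solution (u v : V -> R) : Prop :=
  inHlam u v /\ forall xi eta, inHlam xi eta -> dJlam u v xi eta = 0.

Definition Nehari (u v : V -> R) : Prop :=
  inHlam u v /\ ~ (u = (fun _ => 0) /\ v = (fun _ => 0)) /\ dJlam u v u v = 0.

Definition cNehari : \bar R :=
  ereal_inf [set (Jlam p.1 p.2)%:E | p in [set p : (V -> R) * (V -> R) | Nehari p.1 p.2]].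

End GraphDefs.

(* Main.v *)
(** Write [N u v] for the squared norm of [(u, v)] in [H_lambda], [B u v] for
the integral of [|u|^alpha |v|^beta], and [q] for [(alpha + beta) / 2 > 1].

The supremum of [B] over the unit ball of [N] is attained: along an ultrafilter
of maximizing pairs all values converge pointwise, finite partial sums of the
energy pass to the limit, and, since balls are finite and [a], [b] tend to
infinity, the part of [B] outside a large ball is uniformly small. As [N] and
[B] are homogeneous, a multiple [(u, v)] of the maximizer satisfies
[N u v = B u v = n > 0] and [B xi eta <= n (N xi eta / n)^q] for all pairs.

On the Nehari manifold [N = B], so the inequality forces [N >= n] there, while
[J = (1/2 - 1/(alpha + beta)) N]; hence [(u, v)] is a minimizer. It is a weak
solution because [B] is convex in each argument separately: its first-order
expansion in a direction [xi] lies below [n (N / n)^q], with equality at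
[(u, v)], and so has the same slope. *)

Require Import Defs.
From HB Require Import structures.
From mathcomp Require Import all_boot all_order all_algebra.
From mathcomp Require Import all_classical all_reals all_analysis.
From mathcomp Require Import finmap ring lra.
Import Order.TTheory GRing.Theory Num.Theory.
Import numFieldNormedType.Exports.
Local Open Scope classical_set_scope.
Local Open Scope ring_scope.

Set Implicit Arguments.
Unset Strict Implicit.

(** * Absolutely summable families *)

Local Open Scope classical_set_scope.
Local Open Scope ring_scope.

Section AbsolutelySummable.
Context {R : realType} {I : choiceType}.
Implicit Types f g h : I -> R.

Definition abs_summable f : Prop := (\esum_(i in [set: I]) `|f i|%:E < +oo)%E.

(** Same shape as [intV], so that [intV] of a function and [tsum] of its product with [mu] agree by
    conversion. The value is meaningful only for absolutely summable families. *)
Definition tsum f : R :=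
  fine (\esum_(i in [set: I]) (Num.max (f i) 0)%:E
        - \esum_(i in [set: I]) (Num.max (- f i) 0)%:E)%E.

Lemma abs_summable_le f g :
  (forall i, `|f i| <= g i) -> abs_summable g -> abs_summable f.
Proof.
move=> fg; apply: le_lt_trans; apply: le_esum => i _.
by rewrite lee_fin (le_trans (fg i))// ler_norm.
Qed.

Lemma abs_summableD f g :
  abs_summable f -> abs_summable g -> abs_summable (fun i => f i + g i).
Proof.
move=> sf sg; apply: le_lt_trans (lte_add_pinfty sf sg).
rewrite -esumD//; apply: le_esum => i _.
by rewrite -EFinD lee_fin ler_normD.
Qed.

Lemma nneg_esum_le f (r : R) :
  (forall X : set I, finite_set X -> \sum_(i \in X) f i <= r) ->
  (\esum_(i in [set: I]) (f i)%:E <= r%:E)%E.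
Proof.
move=> fr; apply: ge_ereal_sup => _ [X [finX _] <-].
by rewrite fsumEFin// lee_fin fr.
Qed.

Lemma fsum_le_esum f (X : set I) : finite_set X ->
  ((\sum_(i \in X) f i)%:E <= \esum_(i in [set: I]) (f i)%:E)%E.
Proof.
by move=> finX; apply: esum_ge; exists X => //; rewrite fsumEFin.
Qed.

Lemma abs_summable_bounded f (r : R) : (forall i, 0 <= f i) ->
  (forall X : set I, finite_set X -> \sum_(i \in X) f i <= r) -> abs_summable f.
Proof.
move=> f0 fr; apply: (@le_lt_trans _ _ r%:E); last exact: ltry.
by apply: nneg_esum_le => X finX; under eq_fsbigr do rewrite ger0_norm//; exact: fr.
Qed.

Lemma tsumE f : (forall i, 0 <= f i) -> abs_summable f ->
  (tsum f)%:E = (\esum_(i in [set: I]) (f i)%:E)%E.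
Proof.
move=> f0 sf; rewrite /tsum.
rewrite [X in (_ - X)%E]esum1 ?sube0; last first.
  by move=> i _; rewrite max_r// oppr_le0.
under eq_esum do rewrite max_l//.
rewrite fineK// ge0_fin_numE; last by apply: esum_ge0 => i _; rewrite lee_fin.
by apply: le_lt_trans sf; apply: le_esum => i _; rewrite lee_fin ler_norm.
Qed.

Lemma fsum_le_tsum f (X : set I) : (forall i, 0 <= f i) -> abs_summable f ->
  finite_set X -> \sum_(i \in X) f i <= tsum f.
Proof. by move=> f0 sf finX; rewrite -lee_fin tsumE// fsum_le_esum. Qed.

Lemma tsum_le_bound f (r : R) : (forall i, 0 <= f i) -> abs_summable f ->
  (forall X : set I, finite_set X -> \sum_(i \in X) f i <= r) -> tsum f <= r.
Proof. by move=> f0 sf fr; rewrite -lee_fin tsumE//; exact: nneg_esum_le. Qed.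

Lemma term_le_tsum f i : (forall i, 0 <= f i) -> abs_summable f -> f i <= tsum f.
Proof.
move=> f0 sf; apply: le_trans (fsum_le_tsum f0 sf (finite_set1 i)).
by rewrite fsbig_set1.
Qed.

Lemma nneg_tsumD f g : (forall i, 0 <= f i) -> (forall i, 0 <= g i) ->
  abs_summable f -> abs_summable g ->
  tsum (fun i => f i + g i) = tsum f + tsum g.
Proof.
move=> f0 g0 sf sg; apply: EFin_inj; rewrite EFinD !tsumE//.
- by rewrite -esumD// => i _; rewrite lee_fin.
- by move=> i; rewrite addr_ge0.
- exact: abs_summableD.
Qed.

Lemma abs_summable_norm f : abs_summable f -> abs_summable (fun i => `|f i|).
Proof. by rewrite /abs_summable; under [in X in _ -> X]eq_esum do rewrite normr_id. Qed.

Lemma abs_summable_dom f g :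
  (forall i, `|f i| <= `|g i|) -> abs_summable g -> abs_summable f.
Proof. by move=> fg /abs_summable_norm; exact: abs_summable_le. Qed.

Let pos f i := Num.max (f i) 0.
Let neg f i := Num.max (- f i) 0.

Let pos_ge0 f i : 0 <= pos f i. Proof. by rewrite /pos le_max lexx orbT. Qed.
Let neg_ge0 f i : 0 <= neg f i. Proof. by rewrite /neg le_max lexx orbT. Qed.

Let posBneg f i : f i = pos f i - neg f i.
Proof.
by rewrite /pos /neg; case: (leP (f i) 0) => ?; [rewrite max_l|rewrite max_r]; lra.
Qed.

Let summable_pos f : abs_summable f -> abs_summable (pos f).
Proof.
apply: abs_summable_dom => i.
by rewrite ger0_norm// /pos ge_max ler_norm/=.
Qed.

Let summable_neg f : abs_summable f -> abs_summable (neg f).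
Proof.
apply: abs_summable_dom => i.
by rewrite ger0_norm// /neg ge_max -normrN ler_norm/=.
Qed.

(** Any splitting into nonnegative summable families computes the sum, not only the one into
    positive and negative parts. Linearity then reduces to the nonnegative case. *)
Lemma tsumB_nneg f g h : (forall i, 0 <= g i) -> (forall i, 0 <= h i) ->
  abs_summable g -> abs_summable h -> (forall i, f i = g i - h i) ->
  tsum f = tsum g - tsum h.
Proof.
move=> g0 h0 sg sh fE.
have sf : abs_summable f.
  apply: (@abs_summable_le _ (fun i => g i + h i)) (abs_summableD sg sh) => i.
  by rewrite fE (le_trans (ler_normB _ _))// !ger0_norm.
have [sp sn] := (summable_pos sf, summable_neg sf).
have -> : tsum f = tsum (pos f) - tsum (neg f).
  rewrite {1}/tsum.
  have -> : (\esum_(i in [set: I]) (Num.max (f i) 0)%:E = (tsum (pos f))%:E)%E.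
    by rewrite tsumE.
  have -> : (\esum_(i in [set: I]) (Num.max (- f i) 0)%:E = (tsum (neg f))%:E)%E.
    by rewrite tsumE.
  by [].
(* Both sides are sums of nonnegative families, for which additivity is already known. *)
have : tsum (pos f) + tsum h = tsum g + tsum (neg f).
  rewrite -!nneg_tsumD//; congr tsum; apply/funext => i.
  by have := posBneg f i; rewrite fE; lra.
lra.
Qed.

Lemma tsumD f g : abs_summable f -> abs_summable g ->
  tsum (fun i => f i + g i) = tsum f + tsum g.
Proof.
move=> sf sg.
rewrite (@tsumB_nneg _ (fun i => pos f i + pos g i) (fun i => neg f i + neg g i)).
- rewrite !nneg_tsumD//;
  do ?[exact: summable_pos|exact: summable_neg].
  rewrite (@tsumB_nneg f (pos f) (neg f))//;
  do ?[exact: summable_pos|exact: summable_neg].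
  rewrite (@tsumB_nneg g (pos g) (neg g))//;
  do ?[exact: summable_pos|exact: summable_neg].
  lra.
- by move=> i; rewrite addr_ge0.
- by move=> i; rewrite addr_ge0.
- by apply: abs_summableD; exact: summable_pos.
- by apply: abs_summableD; exact: summable_neg.
- by move=> i; rewrite (posBneg f) (posBneg g); lra.
Qed.

Lemma tsumN f : abs_summable f -> tsum (fun i => - f i) = - tsum f.
Proof.
move=> sf; rewrite (@tsumB_nneg f (pos f) (neg f))//;
  do ?[exact: summable_pos|exact: summable_neg].
rewrite (@tsumB_nneg _ (neg f) (pos f))//;
  do ?[exact: summable_pos|exact: summable_neg].
  lra.
by move=> i; rewrite {1}(posBneg f); lra.
Qed.

Lemma abs_summableN f : abs_summable f -> abs_summable (fun i => - f i).
Proof.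
move=> sf; rewrite /abs_summable.
by under eq_esum do rewrite normrN.
Qed.

Lemma tsum0 : tsum (fun=> 0) = 0.
Proof.
rewrite /tsum !esum1 ?sube0// => i _; by rewrite ?oppr0 maxxx.
Qed.

Lemma tsum_ge0 f : (forall i, 0 <= f i) -> abs_summable f -> 0 <= tsum f.
Proof.
move=> f0 sf; rewrite -lee_fin tsumE//.
by apply: esum_ge0 => i _; rewrite lee_fin.
Qed.

Lemma le_tsum f g : abs_summable f -> abs_summable g ->
  (forall i, f i <= g i) -> tsum f <= tsum g.
Proof.
move=> sf sg fg; rewrite -subr_ge0 -tsumN// -tsumD//; last exact: abs_summableN.
apply: tsum_ge0 => [i|]; first by rewrite subr_ge0.
by apply: abs_summableD => //; exact: abs_summableN.
Qed.

Let nnegZ (c : R) f : 0 <= c -> (forall i, 0 <= f i) -> abs_summable f ->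
  abs_summable (fun i => c * f i) /\ tsum (fun i => c * f i) <= c * tsum f.
Proof.
move=> c0 f0 sf.
have cf0 i : 0 <= c * f i by rewrite mulr_ge0.
have bnd X : finite_set X -> \sum_(i \in X) c * f i <= c * tsum f.
  by move=> finX; rewrite -mulr_fsumr ler_wpM2l// fsum_le_tsum.
split; first exact: abs_summable_bounded bnd.
by apply: tsum_le_bound => //; exact: abs_summable_bounded bnd.
Qed.

Lemma abs_summableZ (c : R) f : abs_summable f -> abs_summable (fun i => c * f i).
Proof.
move=> sf; apply: (@abs_summable_le _ (fun i => `|c| * `|f i|)) => [i|].
  by rewrite normrM.
exact: (proj1 (nnegZ _ _ (abs_summable_norm sf))).
Qed.

Let nneg_tsumZ (c : R) f : 0 <= c -> (forall i, 0 <= f i) -> abs_summable f ->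
  tsum (fun i => c * f i) = c * tsum f.
Proof.
rewrite le_eqVlt => /predU1P[<-|c0] f0 sf.
  by under [in LHS]eq_fun do rewrite mul0r; rewrite tsum0 mul0r.
apply/eqP; rewrite eq_le (nnegZ (ltW c0) f0 sf).2/=.
(* The reverse inequality is [nnegZ] for the factor [c^-1] and the family [c * f]. *)
rewrite -ler_pdivlMl//.
have cf0 i : 0 <= c * f i by rewrite mulr_ge0// ltW.
have := (@nnegZ c^-1 _ _ cf0 (abs_summableZ c sf)).2.
rewrite invr_ge0 ltW// => /(_ isT); apply: le_trans.
by rewrite le_eqVlt; apply/orP; left; apply/eqP; congr tsum;
   apply/funext => i; rewrite mulKf// gt_eqF.
Qed.

Lemma tsumZ (c : R) f : abs_summable f -> tsum (fun i => c * f i) = c * tsum f.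
Proof.
move=> sf; wlog c0 : c / 0 <= c => [wlg|].
  have [|/ltW c0] := leP 0 c; first exact: wlg.
  rewrite -[c]opprK mulNr -wlg ?oppr_ge0// -tsumN; last exact: abs_summableZ.
  by congr tsum; apply/funext => i; rewrite mulNr.
rewrite (@tsumB_nneg f (pos f) (neg f))//;
  do ?[exact: summable_pos|exact: summable_neg].
rewrite mulrBr -!nneg_tsumZ//;
  do ?[exact: summable_pos|exact: summable_neg].
apply: tsumB_nneg.
- by move=> i; rewrite mulr_ge0.
- by move=> i; rewrite mulr_ge0.
- exact/abs_summableZ/summable_pos.
- exact/abs_summableZ/summable_neg.
- by move=> i; rewrite -mulrBr -posBneg.
Qed.

Lemma fsum_le_supp f (X Y : set I) : finite_set X -> finite_set Y ->
  (forall i, 0 <= f i) -> (forall i, ~ X i -> f i = 0) ->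
  \sum_(i \in Y) f i <= \sum_(i \in X) f i.
Proof.
move=> finX finY f0 fX.
rewrite (fsbigID X)//= [X in _ + X]fsbig1 ?addr0; last by move=> i [_ /fX ->].
rewrite [leRHS](fsbigID Y)//= setIC lerDl.
by apply: fsumr_ge0.
Qed.

Lemma abs_summable_fin_supp f (X : set I) : finite_set X ->
  (forall i, ~ X i -> f i = 0) -> abs_summable f.
Proof.
move=> finX f0.
apply: (@abs_summable_le _ (fun i => `|f i|)) => //.
apply: (@abs_summable_bounded _ (\sum_(i \in X) `|f i|)) => // Y finY.
by apply: fsum_le_supp => // i /f0 ->; rewrite normr0.
Qed.

Lemma tsum_fin_supp f (X : set I) : finite_set X -> (forall i, 0 <= f i) ->
  (forall i, ~ X i -> f i = 0) -> tsum f = \sum_(i \in X) f i.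
Proof.
move=> finX f0 fX; have sf := abs_summable_fin_supp finX fX.
apply/eqP; rewrite eq_le fsum_le_tsum// andbT.
by apply: tsum_le_bound => // Y finY; exact: fsum_le_supp.
Qed.

End AbsolutelySummable.

(** * Real powers *)

Local Open Scope classical_set_scope.
Local Open Scope ring_scope.

Section RealPowers.
Context {R : realType}.
Implicit Types x y u h k r s t al q K M : R.

(** Young's inequality for [x] and [1] with the conjugate exponents [al] and [al / (al - 1)],
    multiplied by [al]. *)
Lemma bernoulli_powR al x : 1 < al -> 0 <= x -> 1 + al * (x - 1) <= x `^ al.
Proof.
move=> al1 x0; have al0 : 0 < al by lra.
have := @conjugate_powR R x 1 al (al / (al - 1)) x0 ler01 al0.
rewrite powR1 divr_gt0 ?subr_gt0// => /(_ isT).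
have -> : al^-1 + (al / (al - 1))^-1 = 1 by field; apply/andP; split; lra.
move=> /(_ erefl); rewrite mulr1 -(ler_pM2l al0).
suff -> : al * (x `^ al / al + 1 / (al / (al - 1))) = x `^ al + (al - 1) by lra.
by field; apply/andP; split; lra.
Qed.

(** The tangent at [1] of a concave power, obtained from Bernoulli's inequality with exponent
    [(1 - r)^-1] at [k ^ (1 - r)]. *)
Lemma powR_le_affine r k : 0 < r < 1 -> 0 <= k -> k `^ (1 - r) <= (1 - r) * k + r.
Proof.
move=> /andP[r0 r1] k0.
have al1 : 1 < (1 - r)^-1 by rewrite invf_gt1; lra.
have := bernoulli_powR al1 (powR_ge0 k (1 - r)).
rewrite -powRrM mulfV ?powRr1//; last by lra.
set y := k `^ _ => ky; have ri : 0 < 1 - r by lra.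
have := ler_wpM2l (ltW ri) ky.
rewrite mulrDr mulrA mulfV; lra.
Qed.

Lemma abs_powRsubr2 al u : 1 < al ->
  `| `|u| `^ (al - 2) * u | = `|u| `^ (al - 1).
Proof.
(* The exponent [al - 2] may be negative, but at [0] the factor [u] kills the product, and the right
   side vanishes because [al - 1 > 0]. *)
move=> al1; have [->|u0] := eqVneq u 0.
  by rewrite mulr0 normr0 powR0// subr_eq0 gt_eqF.
rewrite normrM ger0_norm ?powR_ge0//.
rewrite -[X in _ * X = _]powRr1// -powRD; last by rewrite normr_eq0 u0 implybT.
by congr powR; lra.
Qed.

(** Convexity of [|.|^al]. For [u != 0], writing [h = u * t] reduces the claim to Bernoulli's
    inequality at [1 + t]; if [1 + t < 0], then [1 + al * t] is negative. *)
Lemma abs_powR_tangent al u h : 1 < al ->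
  `|u| `^ al + al * (`|u| `^ (al - 2) * u) * h <= `|u + h| `^ al.
Proof.
move=> al1; have [->|u0] := eqVneq u 0.
  rewrite normr0 powR0 ?gt_eqF ?(lt_trans ltr01)//.
  by rewrite !(mulr0, mul0r) addr0 powR_ge0.
have nu0 : 0 < `|u| by rewrite normr_gt0.
pose t := h / u; have -> : h = u * t by rewrite /t mulrC divfK.
have -> : u + u * t = u * (1 + t) by ring.
rewrite normrM powRM//.
have -> : al * (`|u| `^ (al - 2) * u) * (u * t) = `|u| `^ al * (al * t).
  have -> : `|u| `^ al = `|u| `^ (al - 2) * `|u| ^+ 2.
    rewrite -powR_mulrn// -powRD ?normr_eq0 ?u0 ?implybT//.
    by congr powR; lra.
  by rewrite real_normK ?num_real//; ring.
rewrite -[X in X + _]mulr1 -mulrDr ler_wpM2l ?powR_ge0//.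
have [t1|t1] := leP 0 (1 + t).
  by rewrite ger0_norm// (le_trans _ (bernoulli_powR al1 t1))//; lra.
by rewrite (le_trans _ (powR_ge0 _ _))//; nra.
Qed.

(** Keeps one factor [|u|] and bounds the others by [K], so that for bounded functions a product of
    powers above 1 is controlled by a product of first powers. *)
Lemma abs_powR_le al K u : 1 < al -> `|u| <= K -> `|u| `^ al <= K `^ (al - 1) * `|u|.
Proof.
move=> al1 uK; rewrite -[leLHS]mulr_powRB1//; last by lra.
rewrite mulrC ler_wpM2r// ge0_ler_powR ?nnegrE//; first lra.
exact: le_trans uK.
Qed.

(** The tangent inequality is used at each of the two points; both slopes have absolute value at
    most [al * M ^ (al - 1)]. *)
Lemma abs_powR_lipschitz al M x y : 1 < al -> `|x| <= M -> `|y| <= M ->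
  `| `|x| `^ al - `|y| `^ al | <= al * M `^ (al - 1) * `|x - y|.
Proof.
move=> al1.
have one_sided u v : `|u| <= M ->
    `|u| `^ al - `|v| `^ al <= al * M `^ (al - 1) * `|u - v|.
  move=> uM; have := abs_powR_tangent u (v - u) al1.
  have -> : u + (v - u) = v by ring.
  set D := al * _ * _ => uv; suff : - D <= al * M `^ (al - 1) * `|u - v| by lra.
  rewrite (le_trans (ler_norm _))// normrN /D normrM normrM abs_powRsubr2//.
  rewrite gtr0_norm; last by lra.
  rewrite distrC ler_wpM2r// ler_wpM2l//; first lra.
  rewrite ge0_ler_powR ?nnegrE//; first lra.
  exact: le_trans uM.
move=> xM yM; rewrite ler_norml; apply/andP; split; last exact: one_sided.
by have := one_sided y x yM; rewrite distrC; lra.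
Qed.

Lemma continuous_abs_powR al : 1 < al -> continuous (fun x => `|x| `^ al).
Proof.
move=> al1 x; apply/cvgrPdist_le => e e0.
pose L := al * (`|x| + 1) `^ (al - 1) + 1.
have L0 : 0 < L.
  by rewrite /L ltr_wpDl// mulr_ge0 ?powR_ge0//; lra.
near=> y.
have yx1 : `|x - y| <= 1.
  by near: y; apply: (@cvgr_dist_le _ _ _ _ _ id x cvg_id); exact: ltr01.

have yxe : `|x - y| <= e / L.
  by near: y; apply: (@cvgr_dist_le _ _ _ _ _ id x cvg_id); exact: divr_gt0.
have yM : `|y| <= `|x| + 1.
  have -> : y = x - (x - y) by ring.
  by rewrite (le_trans (ler_normB _ _))// lerD2l.
have xM : `|x| <= `|x| + 1 by lra.
apply: (le_trans (abs_powR_lipschitz al1 xM yM)).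
apply: (@le_trans _ _ (L * `|x - y|)).
  by rewrite ler_wpM2r// /L; lra.
by rewrite mulrC -ler_pdivlMr.
Unshelve. all: by end_near. Qed.

(** Near [0] the linear term dominates, so a nonzero [A] would make the polynomial negative for
    small [s] of the opposite sign. *)
Lemma cubic_ge0_linear_coef (A B C d : R) : 0 < d ->
  (forall s, `|s| <= d -> 0 <= s * A + s ^+ 2 * B + s ^+ 3 * C) -> A = 0.
Proof.
(* Replacing [s] by [- s] changes the signs of [A] and [C] and keeps [B]. *)
move=> d0; wlog A0 : A C / 0 <= A => [wlg H|H].
  have [A0|/ltW A0] := leP 0 A; first exact: wlg H.
  apply/eqP; rewrite -oppr_eq0; apply/eqP.
  apply: (wlg (- A) (- C)) => [|s sd]; first by rewrite oppr_ge0.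
  have := H (- s); rewrite normrN => /(_ sd).
  by congr (0 <= _); ring.
apply/eqP; rewrite eq_le A0 andbT leNgt; apply/negP => Agt0.
pose D := 1 + `|B| + `|C|.
have D0 : 0 < D by rewrite /D -addrA ltr_pwDl// addr_ge0.
(* The bound [1] lets [t ^+ 2] dominate [t ^+ 3], [d] makes [- t] eligible, and [A / (2 * D)] keeps
   the higher terms below half of [t * A]. *)
pose t := Num.min (Num.min 1 d) (A / (2 * D)).
have t0 : 0 < t by rewrite !lt_min ltr01 d0/= divr_gt0// mulr_gt0.
have t1 : t <= 1 by rewrite !ge_min lexx.
have td : t <= d by rewrite !ge_min lexx orbT.
have tA : t * D <= A / 2.
  rewrite -ler_pdivlMr// -mulrA -invfM ge_min lexx orbT//.
have := H (- t); rewrite normrN gtr0_norm// => /(_ td).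
rewrite sqrrN !mulNr exprNn.
have -> : (-1) ^+ 3 = -1 :> R by ring.
rewrite mulN1r mulNr => P.
have : t * A <= t * (t * D).
  have : t ^+ 2 * B <= t ^+ 2 * `|B| by rewrite ler_wpM2l ?sqr_ge0 ?ler_norm.
  have : - (t ^+ 3 * C) <= t ^+ 2 * `|C|.
    apply: (@le_trans _ _ (t ^+ 3 * `|C|)).
      by rewrite -mulrN ler_wpM2l ?exprn_ge0 ?(ltW t0)// -normrN ler_norm.
    by rewrite ler_wpM2r// exprS ler_piMl// sqr_ge0.
  have := sqr_ge0 t; rewrite /D; lra.
rewrite ler_pM2l//; lra.
Qed.

(* Taking [q]-th roots and bounding the concave power by its tangent makes
   the hypothesis polynomial in [s], so no derivative is needed. *)
Lemma powR_quadratic_tangent (q l c d : R) : 1 < q ->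
  (forall s, 0 <= 1 + 2 * s * c + s ^+ 2 * d) ->
  (forall s, 1 + s * l <= (1 + 2 * s * c + s ^+ 2 * d) `^ q) ->
  l = 2 * q * c.
Proof.
move=> q1 X0 H; pose r := q^-1; have q0 : 0 < q by lra.
have r0 : 0 < r by rewrite invr_gt0.
have r1 : r < 1 by rewrite invf_lt1.
suff : 2 * c - r * l = 0.
  move/eqP; rewrite subr_eq0 => /eqP E.
  by rewrite mulrAC E /r mulrAC mulVf ?mul1r// gt_eqF.
(* The cubic is [X * ((1 - r) * k + r) - k] expanded in [s], where [k = 1 + s * l]; the radius
   ensures [|s * l| <= 1], hence [0 <= k]. *)
apply: (@cubic_ge0_linear_coef _ (d + 2 * c * ((1 - r) * l)) (d * ((1 - r) * l))
   (`|l| + 1)^-1).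
  by rewrite invr_gt0 ltr_wpDl.
move=> s sl.
have k0 : 0 <= 1 + s * l.
  have : `|s * l| <= 1.
    rewrite normrM (le_trans (ler_wpM2r _ sl))//.
    by rewrite mulrC ler_pdivrMr ?ltr_wpDl// mul1r lerDl.
  by rewrite ler_norml; lra.
set k := 1 + s * l in k0.
set X := 1 + 2 * s * c + s ^+ 2 * d.
have kX : k `^ r <= X.
  have -> : X = (X `^ q) `^ r by rewrite -powRrM mulfV ?powRr1 ?X0 ?gt_eqF.
  by rewrite ge0_ler_powR ?nnegrE ?powR_ge0 ?(ltW r0)//; exact: H.
(* Split [k] as [k ^ r * k ^ (1 - r)]: the first factor is at most [X], the second at most its
   tangent at [1]. *)
have : k <= X * ((1 - r) * k + r).
  have {1}-> : k = k `^ r * k `^ (1 - r).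
    rewrite -powRD; last by rewrite addrC subrK oner_eq0.
    by rewrite addrC subrK powRr1.
  by apply: ler_pM; rewrite ?powR_ge0// powR_le_affine// r0.
rewrite /X /k; nra.
Qed.

End RealPowers.

(** * The energy form *)

Section EnergyForm.
Context {R : realType} {V : choiceType} (w : V -> V -> R) (mu : V -> R).
Hypotheses (w_sym : forall x y, w x y = w y x) (w_ge0 : forall x y, 0 <= w x y).
Hypotheses (w_fin : locally_finite w) (mu_gt0 : forall x, 0 < mu x).
Implicit Types (u xi : V -> R) (s t : R).

Lemma GamE u xi x : Gam w mu u xi x =
  (2 * mu x)^-1 * \sum_(y <- fset_set (nbrs w x)) w x y * (u y - u x) * (xi y - xi x).
Proof. by rewrite /Gam fsbig_finite. Qed.

Let imu x : 0 <= (2 * mu x)^-1.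
Proof. by rewrite invr_ge0 mulr_ge0// ltW. Qed.

Lemma Gam_ge0 u x : 0 <= Gam w mu u u x.
Proof.
rewrite GamE mulr_ge0// sumr_ge0// => y _.
by rewrite -mulrA mulr_ge0// -expr2 sqr_ge0.
Qed.

Lemma Gam_quad u xi s x :
  Gam w mu (fun y => u y + s * xi y) (fun y => u y + s * xi y) x =
  Gam w mu u u x + 2 * s * Gam w mu u xi x + s ^+ 2 * Gam w mu xi xi x.
Proof.
rewrite !GamE [2 * s * _]mulrCA [s ^+ 2 * _]mulrCA -!mulrDr; congr (_ * _).
rewrite !mulr_sumr -!big_split/=; apply: eq_bigr => y _; ring.
Qed.

Lemma GamZ u xi s t x :
  Gam w mu (fun y => s * u y) (fun y => t * xi y) x = s * t * Gam w mu u xi x.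
Proof.
rewrite !GamE [RHS]mulrCA; congr (_ * _).
by rewrite mulr_sumr; apply: eq_bigr => y _; ring.
Qed.

Lemma Gam_cvg (T : Type) (F : set_system T) (FF : Filter F) (p : T -> V -> R) u x :
  (forall y, p t y @[t --> F] --> u y) ->
  Gam w mu (p t) (p t) x @[t --> F] --> Gam w mu u u x.
Proof.
move=> pu; under eq_cvg do rewrite GamE; rewrite GamE.
apply: cvgM; first exact: cvg_cst.
apply: cvg_big => [|y _]; first exact: add_continuous.
apply: cvgM; last by apply: cvgB; exact: pu.
by apply: cvgM; [exact: cvg_cst|apply: cvgB; exact: pu].
Qed.

Variable c : V -> R.
Hypothesis c_ge1 : forall x, 1 <= c x.

(** The coefficient [c] stands for [lambda * a + 1] or [lambda * b + 1], so one scalar form serves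
    both components. *)
Definition energy_density u xi x : R := mu x * (Gam w mu u xi x + c x * u x * xi x).

Local Notation q := energy_density.

Definition finite_energy u : Prop := abs_summable (q u u).

Definition energy u xi : R := tsum (q u xi).

Lemma energy_density_ge u x : mu x * (c x * u x ^+ 2) <= q u u x.
Proof.
rewrite /q ler_wpM2l ?(ltW (mu_gt0 x))// -mulrA -expr2 lerDr.
exact: Gam_ge0.
Qed.

Lemma energy_density_ge_sqr u x : mu x * u x ^+ 2 <= q u u x.
Proof.
apply: le_trans (energy_density_ge u x).
by rewrite ler_wpM2l ?(ltW (mu_gt0 x))// ler_peMl// sqr_ge0.
Qed.

Lemma energy_density_ge0 u x : 0 <= q u u x.
Proof.
apply: le_trans (energy_density_ge_sqr u x).
by rewrite mulr_ge0 ?sqr_ge0// ltW.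
Qed.

Lemma energy_density_quad u xi s x :
  q (fun y => u y + s * xi y) (fun y => u y + s * xi y) x =
  q u u x + 2 * s * q u xi x + s ^+ 2 * q xi xi x.
Proof. by rewrite /q Gam_quad; ring. Qed.

Lemma energy_densityZ u xi s t x :
  q (fun y => s * u y) (fun y => t * xi y) x = s * t * q u xi x.
Proof. by rewrite /q GamZ; ring. Qed.

(** Nonnegativity of the form at [u + xi] and [u - xi]. The constant is not sharp, but summability
    is all that is wanted. *)
Lemma energy_density_cauchy u xi x : `|q u xi x| <= q u u x + q xi xi x.
Proof.
have := energy_density_ge0 (fun y => u y + 1 * xi y) x.
have := energy_density_ge0 (fun y => u y + (- 1) * xi y) x.
have := energy_density_ge0 u x; have := energy_density_ge0 xi x.
by rewrite !energy_density_quad ler_norml sqrrN expr1n => *; apply/andP; split; lra.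
Qed.

Lemma energy_density_cvg (T : Type) (F : set_system T) (FF : Filter F)
    (p : T -> V -> R) u x :
  (forall y, p t y @[t --> F] --> u y) -> q (p t) (p t) x @[t --> F] --> q u u x.
Proof.
move=> pu; apply: cvgM; first exact: cvg_cst.
apply: cvgD; first exact: Gam_cvg.
by apply: cvgM; [apply: cvgM; [exact: cvg_cst|exact: pu]|exact: pu].
Qed.

Lemma abs_summable_energy u xi :
  finite_energy u -> finite_energy xi -> abs_summable (q u xi).
Proof.
move=> Eu Exi; apply: abs_summable_le (abs_summableD Eu Exi).
exact: energy_density_cauchy.
Qed.

Lemma finite_energyD u xi s : finite_energy u -> finite_energy xi ->
  finite_energy (fun y => u y + s * xi y).
Proof.
move=> Eu Exi; rewrite /finite_energy; rewrite (funext (energy_density_quad u xi s)).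
apply: abs_summableD; last exact: abs_summableZ.
by apply: abs_summableD => //; apply: abs_summableZ; exact: abs_summable_energy.
Qed.

Lemma energy_quad u xi s : finite_energy u -> finite_energy xi ->
  energy (fun y => u y + s * xi y) (fun y => u y + s * xi y) =
  energy u u + 2 * s * energy u xi + s ^+ 2 * energy xi xi.
Proof.
move=> Eu Exi; have Euxi := abs_summable_energy Eu Exi.
rewrite /energy; rewrite (funext (energy_density_quad u xi s)).
rewrite tsumD; first last.
- exact: abs_summableZ.
- by apply: abs_summableD => //; exact: abs_summableZ.
by rewrite tsumD//; [rewrite !tsumZ|exact: abs_summableZ].
Qed.

Lemma finite_energyZ u s : finite_energy u -> finite_energy (fun y => s * u y).
Proof.
move=> Eu; rewrite /finite_energy; rewrite (funext (energy_densityZ u u s s)).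
exact: abs_summableZ.
Qed.

Lemma energyZ u s : finite_energy u ->
  energy (fun y => s * u y) (fun y => s * u y) = s ^+ 2 * energy u u.
Proof.
move=> Eu; rewrite /energy; rewrite (funext (energy_densityZ u u s s)).
by rewrite tsumZ// expr2.
Qed.

Lemma energy_ge0 u : finite_energy u -> 0 <= energy u u.
Proof. by move=> Eu; apply: tsum_ge0 => // x; exact: energy_density_ge0. Qed.

Lemma abs_summable_sqr u : finite_energy u -> abs_summable (fun x => mu x * u x ^+ 2).
Proof.
apply: abs_summable_le => x; rewrite ger0_norm ?energy_density_ge_sqr//.
by rewrite mulr_ge0 ?sqr_ge0// ltW.
Qed.

Lemma sqr_le_energy u x : finite_energy u -> mu x * u x ^+ 2 <= energy u u.
Proof.
move=> Eu; apply: le_trans (energy_density_ge_sqr u x) _.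
by apply: term_le_tsum => // y; exact: energy_density_ge0.
Qed.

(** The density vanishes off [x0] and its finitely many neighbours. This function later shows that
    the maximal interaction is positive. *)
Lemma finite_energy_indicator x0 : finite_energy (fun x => (x == x0)%:R).
Proof.
apply: (@abs_summable_fin_supp _ _ _ ([set x0] `|` nbrs w x0)).
  by rewrite finite_setU; split; [exact: finite_set1|exact: w_fin].
move=> x /not_orP[/eqP/negPf xx0 nx].
rewrite /q GamE xx0 mulr0 addr0 big_seq big1 ?mulr0// => y.
rewrite in_fset_set// => /set_mem xy; case: eqP => [yx0|_].
  by case: nx; rewrite /nbrs/= w_sym -yx0.
by rewrite subrr !mulr0.
Qed.

End EnergyForm.

(** * Finiteness of balls in a locally finite graph *)

Lemma finite_walks {R : realType} {V : choiceType} (w : V -> V -> R) n z :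
  (forall x y, w x y = w y x) -> locally_finite w ->
  finite_set [set x | walk w n x z].
Proof.
move=> w_sym w_fin; elim: n z => [|n IHn] z.
  apply: (@sub_finite_set _ _ [set z]); last exact: finite_set1.
  by move=> x /= H; inversion H.
(* The last vertex before [z] on the walk is a neighbour of [z]. *)
apply: (@sub_finite_set _ _ (\bigcup_(y in nbrs w z) [set x | walk w n x y])).
  move=> x /= H; inversion H; subst; exists y => //.
  by rewrite /nbrs/= w_sym.
by apply: bigcup_finite => // y _; exact: IHn.
Qed.

Lemma finite_ball {R : realType} {V : choiceType} (w : V -> V -> R) x0 n :
  (forall x y, w x y = w y x) -> locally_finite w ->
  finite_set [set x | dist_le w x x0 n].
Proof.
move=> w_sym w_fin.
apply: (@sub_finite_set _ _ (\bigcup_(m in `I_n.+1) [set x | walk w m x x0])).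
  by move=> x [m mn xm]; exists m.
by apply: bigcup_finite => // m _; exact: finite_walks.
Qed.

(** * The interaction term *)

Section Interaction.
Context {R : realType} {V : choiceType} (mu : V -> R).
Hypothesis mu_gt0 : forall x, 0 < mu x.
Implicit Types (u v xi : V -> R) (s t al be K : R).

Definition interaction al be u v : R :=
  tsum (fun x => mu x * (`|u x| `^ al * `|v x| `^ be)).

Lemma interactionC al be u v : interaction al be u v = interaction be al v u.
Proof. by congr tsum; apply/funext => x; rewrite [_ `^ al * _]mulrC. Qed.

Lemma interaction_density_ge0 al be u v x :
  0 <= mu x * (`|u x| `^ al * `|v x| `^ be).
Proof. by rewrite !mulr_ge0 ?powR_ge0// ltW. Qed.

(** Each power is reduced to first degree by [abs_powR_le]; then [|u| * |v| <= u ^+ 2 + v ^+ 2]. *)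
Lemma interaction_density_le al be K u v x : 1 < al -> 1 < be ->
  `|u x| <= K -> `|v x| <= K ->
  mu x * (`|u x| `^ al * `|v x| `^ be) <=
  K `^ (al - 1) * K `^ (be - 1) * (mu x * u x ^+ 2 + mu x * v x ^+ 2).
Proof.
move=> al1 be1 uK vK.
rewrite -mulrDr [leRHS]mulrCA ler_wpM2l ?(ltW (mu_gt0 x))//.
have /(ler_pM (powR_ge0 _ _) (powR_ge0 _ _) (abs_powR_le al1 uK)) := abs_powR_le be1 vK.
move=> /le_trans; apply; rewrite mulrACA ler_wpM2l ?mulr_ge0 ?powR_ge0//.
rewrite -(real_normK (num_real (u x))) -(real_normK (num_real (v x))).
have := sqr_ge0 (`|u x| - `|v x|); have := sqr_ge0 `|u x|; have := sqr_ge0 `|v x|.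
nra.
Qed.

Definition square_summable u : Prop := abs_summable (fun x => mu x * u x ^+ 2).

Lemma abs_summable_interaction al be K u v : 1 < al -> 1 < be ->
  (forall x, `|u x| <= K) -> (forall x, `|v x| <= K) ->
  square_summable u -> square_summable v ->
  abs_summable (fun x => mu x * (`|u x| `^ al * `|v x| `^ be)).
Proof.
move=> al1 be1 uK vK su sv.
apply: abs_summable_le
  (abs_summableZ (K `^ (al - 1) * K `^ (be - 1)) (abs_summableD su sv)).
by move=> x; rewrite ger0_norm ?interaction_density_ge0// interaction_density_le.
Qed.

(** The factor in [u] is at most [K ^ (al - 1)] in absolute value and [|v| ^ be] at most
    [K ^ (be - 1) * |v|]; the remaining [|v| * |xi|] is bounded by squares. *)
Lemma abs_summable_interaction_deriv al be K u v xi : 1 < al -> 1 < be ->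
  (forall x, `|u x| <= K) -> (forall x, `|v x| <= K) ->
  square_summable v -> square_summable xi ->
  abs_summable (fun x => mu x * (`|u x| `^ (al - 2) * u x * `|v x| `^ be * xi x)).
Proof.
move=> al1 be1 uK vK sv sxi.
apply: abs_summable_le
  (abs_summableZ (K `^ (al - 1) * K `^ (be - 1)) (abs_summableD sv sxi)).
move=> x; rewrite normrM gtr0_norm// -mulrDr [leRHS]mulrCA ler_wpM2l ?(ltW (mu_gt0 x))//.
rewrite !normrM -normrM abs_powRsubr2// [ `|_ `^ be|]ger0_norm ?powR_ge0//.
have K0 : 0 <= K by apply: le_trans (uK x).
have h1 : `|u x| `^ (al - 1) <= K `^ (al - 1).
  by rewrite ge0_ler_powR ?nnegrE// subr_ge0 ltW.
have h2 := ler_pM (powR_ge0 _ _) (powR_ge0 _ _) h1 (abs_powR_le be1 (vK x)).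
apply: le_trans (ler_wpM2r (normr_ge0 _) h2) _.
rewrite !mulrA -!mulrA; do 2 rewrite ler_wpM2l ?powR_ge0//.
rewrite -(real_normK (num_real (v x))) -(real_normK (num_real (xi x))).
have := sqr_ge0 (`|v x| - `|xi x|); have := sqr_ge0 `|v x|; have := sqr_ge0 `|xi x|.
nra.
Qed.

Lemma interactionZ al be K u v t : 1 < al -> 1 < be -> 0 <= t ->
  (forall x, `|u x| <= K) -> (forall x, `|v x| <= K) ->
  square_summable u -> square_summable v ->
  interaction al be (fun x => t * u x) (fun x => t * v x) =
  t `^ (al + be) * interaction al be u v.
Proof.
move=> al1 be1 t0 uK vK su sv.
rewrite -tsumZ; last exact: abs_summable_interaction su sv.
congr tsum; apply/funext => x; rewrite !normrM (ger0_norm t0) !powRM//.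
rewrite powRD; last by apply/implyP; rewrite gt_eqF//; lra.
by ring.
Qed.

(* Pointwise convexity of [|.|^al]. *)
Lemma interaction_tangent al be K u v xi s : 1 < al -> 1 < be ->
  (forall x, `|u x| <= K) -> (forall x, `|v x| <= K) -> (forall x, `|xi x| <= K) ->
  square_summable u -> square_summable v -> square_summable xi ->
  square_summable (fun x => u x + s * xi x) ->
  interaction al be u v + s * (al *
    tsum (fun x => mu x * (`|u x| `^ (al - 2) * u x * `|v x| `^ be * xi x))) <=
  interaction al be (fun x => u x + s * xi x) v.
Proof.
move=> al1 be1 uK vK xiK su sv sxi suxi.
have sL := abs_summable_interaction_deriv al1 be1 uK vK sv sxi.
have sB := abs_summable_interaction al1 be1 uK vK su sv.
rewrite mulrA -tsumZ// /interaction -tsumD//; last exact: abs_summableZ.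
apply: le_tsum.
- by apply: abs_summableD => //; exact: abs_summableZ.
- apply: (@abs_summable_interaction _ _ (K + `|s| * K)) => // x.
    by rewrite (le_trans (ler_normD _ _))// lerD// normrM ler_wpM2l.
  rewrite (le_trans (vK x))// lerDl mulr_ge0//; exact: le_trans (vK x).
- move=> x; have := abs_powR_tangent (u x) (s * xi x) al1.
  set A := `|u x| `^ al; set D := `|u x| `^ _; set C := `|_ + _| `^ al.
  set W := `|v x| `^ be => T.
  have mW : 0 <= mu x * W by rewrite mulr_ge0 ?powR_ge0// ltW.
  have := ler_wpM2l mW T; nra.
Qed.

End Interaction.

(** * Existence of a maximizer *)

(** Compactness of [[-K, K]] gives a cluster point, which for an ultrafilter is a limit. One
    ultrafilter thus serves all vertices at once, in place of a diagonal subsequence. *)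
Lemma ultrafilter_bounded_cvg {R : realType} (T : Type) (F : set_system T)
    (h : T -> R) (K : R) : UltraFilter F -> F [set t | `|h t| <= K] ->
  exists l : R, h t @[t --> F] --> l.
Proof.
move=> FU FK.
have [l [_ hl]] : `[-K, K]%classic `&` cluster (h @ F) !=set0.
  apply: (@segment_compact R (- K) K).
  apply: (@filterS _ F _ _ (h @^-1` _)) FK => t tK.
  by rewrite /= in_itv/= -ler_norml.
exists l => A Al; rewrite /nbhs/= /fmap.
have [//|FA] := in_ultra_setVsetC (h @^-1` A) FU.
by have [y []] := hl (~` A) A FA Al.
Qed.

Section MaximalInteraction.
Context {R : realType} {V : choiceType} (w : V -> V -> R) (mu : V -> R).
Variables (mu_min al be : R) (ca cb : V -> R).
Hypotheses (w_ge0 : forall x y, 0 <= w x y) (w_fin : locally_finite w).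
Hypotheses (mu_min_gt0 : 0 < mu_min) (mu_ge : forall x, mu_min <= mu x).
Hypotheses (al_gt1 : 1 < al) (be_gt1 : 1 < be).
Hypotheses (ca_ge1 : forall x, 1 <= ca x) (cb_ge1 : forall x, 1 <= cb x).
Implicit Types u v xi eta : V -> R.

Local Notation B := (interaction mu al be).

(** Working form of membership in [H_lambda], with [ca] and [cb] standing for [lambda * a + 1] and
    [lambda * b + 1]. *)
Definition admissible u v := finite_energy w mu ca u /\ finite_energy w mu cb v.

Definition pair_energy u v := energy w mu ca u u + energy w mu cb v v.

Local Notation N := pair_energy.

Let mu_gt0 x : 0 < mu x. Proof. exact: lt_le_trans (mu_ge x). Qed.

(** The energy dominates [mu_min * u x ^+ 2]. From [u x ^+ 2 <= m <= (1 + m) ^+ 2] one gets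
    [|u x| <= 1 + m] without a square root. *)
Lemma finite_energy_bounded c u x : (forall x, 1 <= c x) -> finite_energy w mu c u ->
  `|u x| <= 1 + energy w mu c u u / mu_min.
Proof.
move=> c1 Eu; have := sqr_le_energy w_ge0 w_fin mu_gt0 c1 x Eu.
have : mu_min * u x ^+ 2 <= mu x * u x ^+ 2 by rewrite ler_wpM2r ?sqr_ge0.
move=> /le_trans /[apply].
rewrite mulrC -ler_pdivlMr//; set m := _ / _ => um.
have m0 : 0 <= m by apply: le_trans um; rewrite sqr_ge0.
rewrite -(@ler_pXn2r _ 2) ?nnegrE// ?addr_ge0// real_normK ?num_real//.
by apply: le_trans um _; nra.
Qed.

Lemma admissible_bounded u v : admissible u v -> exists K : R,
  (forall x, `|u x| <= K) /\ (forall x, `|v x| <= K).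
Proof.
move=> [Eu Ev].
exists (Num.max (1 + energy w mu ca u u / mu_min) (1 + energy w mu cb v v / mu_min)).
split=> x; rewrite le_max; apply/orP; [left|right]; exact: finite_energy_bounded.
Qed.

Lemma admissible_sqr u v :
  admissible u v -> square_summable mu u /\ square_summable mu v.
Proof.
by move=> [Eu Ev]; split; [exact: abs_summable_sqr Eu|exact: abs_summable_sqr Ev].
Qed.

Lemma abs_summable_admissible u v : admissible u v ->
  abs_summable (fun x => mu x * (`|u x| `^ al * `|v x| `^ be)).
Proof.
move=> uv; have [K [uK vK]] := admissible_bounded uv.
by have [] := admissible_sqr uv; exact: abs_summable_interaction uK vK.
Qed.

Lemma pair_energy_ge0 u v : admissible u v -> 0 <= N u v.
Proof. by move=> [? ?]; rewrite addr_ge0 ?energy_ge0. Qed.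

(** [K] bounds both components pointwise on the unit ball of [N], and [C] is the resulting constant
    in [interaction_density_le]. *)
Let K : R := 1 + mu_min^-1.
Let C : R := K `^ (al - 1) * K `^ (be - 1).
Let e u v x := energy_density w mu ca u u x + energy_density w mu cb v v x.

Let K_gt0 : 0 < K. Proof. by rewrite ltr_wpDl ?invr_gt0// ltW. Qed.
Let C_gt0 : 0 < C. Proof. by rewrite mulr_gt0 ?powR_gt0. Qed.

Let e_ge0 u v x : 0 <= e u v x.
Proof. by rewrite addr_ge0 ?energy_density_ge0. Qed.

Let summable_e u v : admissible u v -> abs_summable (e u v).
Proof. by move=> [? ?]; exact: abs_summableD. Qed.

Let tsum_e u v : admissible u v -> tsum (e u v) = N u v.
Proof. by move=> [? ?]; rewrite tsumD. Qed.

Let unit_ball_le u v x : admissible u v -> N u v <= 1 -> `|u x| <= K /\ `|v x| <= K.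
Proof.
move=> [Eu Ev] uv1; have Nu := energy_ge0 w_ge0 w_fin mu_gt0 ca_ge1 Eu.
have Nv := energy_ge0 w_ge0 w_fin mu_gt0 cb_ge1 Ev; rewrite /N in uv1.
split; [apply: le_trans (finite_energy_bounded x ca_ge1 Eu) _
       |apply: le_trans (finite_energy_bounded x cb_ge1 Ev) _];
  by rewrite lerD2l ler_piMl ?invr_ge0 ?(ltW mu_min_gt0)//; lra.
Qed.

Let interaction_unit_ball u v : admissible u v -> N u v <= 1 -> B u v <= C.
Proof.
move=> uv uv1; have ub x := unit_ball_le x uv uv1.
apply: (@le_trans _ _ (C * N u v)); last by rewrite ler_piMr// ltW.
rewrite -tsum_e// -tsumZ//; last exact: summable_e.
apply: le_tsum; [exact: abs_summable_admissible|exact/abs_summableZ/summable_e|].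
move=> x; have [uK vK] := ub x.
apply: le_trans (interaction_density_le mu_gt0 al_gt1 be_gt1 uK vK) _.
rewrite -/C ler_wpM2l ?(ltW C_gt0)//.
by rewrite lerD// energy_density_ge_sqr.
Qed.

Hypothesis coercive : forall M : R, exists X : set V, finite_set X /\
  forall x, ~ X x -> M <= ca x /\ M <= cb x.

(** Where both coefficients exceed [C / eps], the interaction density is at most [eps] times the
    energy density, and the total energy is at most 1. The set [X] does not depend on the pair. *)
Lemma interaction_tail (eps : R) : 0 < eps -> exists X : set V, finite_set X /\
  forall u v, admissible u v -> N u v <= 1 ->
    B u v <= \sum_(x \in X) mu x * (`|u x| `^ al * `|v x| `^ be) + eps.
Proof.
move=> eps0; have [X [finX cX]] := coercive (C / eps).
exists X; split=> // u v uv uv1; have ub x := unit_ball_le x uv uv1.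
pose f x := mu x * (`|u x| `^ al * `|v x| `^ be).
have f0 x : 0 <= f x by exact: interaction_density_ge0.
(* Extending the finite sum by zero turns the claim into a termwise comparison of summable
   families. *)
pose g x := if x \in X then f x else 0.
have g0 x : 0 <= g x by rewrite /g; case: ifP.
have gX x : ~ X x -> g x = 0 by rewrite /g; case: ifPn => // /set_mem.
have -> : \sum_(x \in X) mu x * (`|u x| `^ al * `|v x| `^ be) = tsum g.
  rewrite (tsum_fin_supp finX)//; apply: eq_fsbigr => x xX.
  by rewrite /g xX.
have sg := abs_summable_fin_supp finX gX.
have se := abs_summableZ eps (summable_e uv).
apply: (@le_trans _ _ (tsum g + eps * N u v)); last by rewrite lerD2l ler_piMr// ltW.
rewrite -tsum_e// -tsumZ//; last exact: summable_e.
rewrite -tsumD//; apply: le_tsum; [exact: abs_summable_admissible|exact: abs_summableD|].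
move=> x; rewrite -/(f x) /g; case: ifPn => [_|/negP xX].
  by rewrite lerDl mulr_ge0// ltW.
have [uK vK] := ub x; rewrite add0r.
apply: le_trans (interaction_density_le mu_gt0 al_gt1 be_gt1 uK vK) _; rewrite -/C.
have [Ma Mb] : C / eps <= ca x /\ C / eps <= cb x.
  by apply: cX => Xx; apply: xX; exact: mem_set.
have big c t : C / eps <= c -> C * (mu x * t ^+ 2) <= eps * (mu x * (c * t ^+ 2)).
  rewrite ler_pdivrMr// => Cc; have : 0 <= mu x * t ^+ 2.
    by rewrite mulr_ge0 ?sqr_ge0// ltW.
  move=> m0; have := ler_wpM2r m0 Cc; nra.
rewrite mulrDr (le_trans (lerD (big _ _ Ma) (big _ _ Mb)))// -mulrDr.
rewrite ler_wpM2l ?(ltW eps0)//.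
by rewrite lerD// energy_density_ge.
Qed.

Lemma interaction_max : exists u v, [/\ admissible u v, N u v <= 1 &
  forall xi eta, admissible xi eta -> N xi eta <= 1 -> B xi eta <= B u v].
Proof.
pose ball := [set p : (V -> R) * (V -> R) | admissible p.1 p.2 /\ N p.1 p.2 <= 1].
pose S := sup [set B p.1 p.2 | p in ball].
have supB : has_sup [set B p.1 p.2 | p in ball].
  split.
    have E0 c : finite_energy w mu c (fun=> 0).
      apply: (@abs_summable_fin_supp _ _ _ set0); first exact: finite_set0.
      move=> x _; rewrite /energy_density mulr0 addr0 GamE// big1 ?mulr0// => y _.
      by rewrite subrr mulr0.
    exists (B (fun=> 0) (fun=> 0)), (fun=> 0, fun=> 0) => //.
    split=> //=; rewrite /N.
    have Z c : energy w mu c (fun=> 0) (fun=> 0) = 0.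
      have -> : (fun=> 0) = (fun x : V => 0 * (0 : R)).
        by apply/funext => x; rewrite mul0r.
      by rewrite (energyZ w_fin 0 (E0 c)) expr0n mul0r.
    by rewrite !Z addr0.
  by exists C => _ [p [pa pb] <-]; exact: interaction_unit_ball.
have leS xi eta : admissible xi eta -> N xi eta <= 1 -> B xi eta <= S.
  by move=> ad N1; apply: sup_upper_bound => //; exists (xi, eta).
(* Pairs of the ball within [d] of the supremum. These sets form a base of a proper filter, and an
   ultrafilter refining it plays the role of a maximizing sequence. *)
pose top (d : R) := [set p | ball p /\ S - d < B p.1 p.2].
have topF : ProperFilter (filter_from [set d | 0 < d] top).
  apply: filter_from_proper.
    apply: filter_from_filter; first by exists 1; rewrite /=.
    move=> d1 d2 /= d10 d20; exists (Num.min d1 d2); first by rewrite /= lt_min d10.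
    move=> p [bp Sp]; split; split=> //; apply: le_lt_trans Sp; rewrite lerD2l lerN2.
      by rewrite ge_min lexx.
    by rewrite ge_min lexx orbT.
  by move=> d d0; have [_ [p bp <-] Sp] := sup_adherent d0 supB; exists p.
have [F [FU topF_sub]] := ultraFilterLemma topF.
have Ftop d : 0 < d -> F (top d) by move=> d0; apply: topF_sub; exists d.
have Fball : F ball by apply: filterS (Ftop _ ltr01) => p [].
have lim1 x : exists l : R, p.1 x @[p --> F] --> l.
  apply: (@ultrafilter_bounded_cvg _ _ _ _ K); apply: filterS Fball => p [pa pb] /=.
  by have [] := unit_ball_le x pa pb.
have lim2 x : exists l : R, p.2 x @[p --> F] --> l.
  apply: (@ultrafilter_bounded_cvg _ _ _ _ K); apply: filterS Fball => p [pa pb] /=.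
  by have [] := unit_ball_le x pa pb.
have [u pu] := choice lim1; have [v pv] := choice lim2.
(* Fatou's argument: a finite sum of densities involves finitely many vertices, so its bound
   survives the pointwise limit. *)
have e_le X : finite_set X -> \sum_(x \in X) e u v x <= 1.
  move=> finX; rewrite fsbig_finite//.
  apply: (@cvgr_to_le _ F _ _ (fun p => \sum_(x <- fset_set X) e p.1 p.2 x)).
    apply: cvg_big => [|x _]; first exact: add_continuous.
    by apply: cvgD; exact: energy_density_cvg.
  apply: filterS Fball => p [pa pb]; rewrite -fsbig_finite//.
  apply: le_trans pb; rewrite -tsum_e//; apply: fsum_le_tsum => //.
  exact: summable_e.
have part_le (f : V -> R) X : (forall x, f x <= e u v x) -> finite_set X ->
    \sum_(x \in X) f x <= 1.
  move=> fe finX; apply: le_trans (e_le X finX).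
  by rewrite !fsbig_finite//; apply: ler_sum => x _; exact: fe.
have ad : admissible u v.
  split; apply: (@abs_summable_bounded _ _ _ 1).
  - by move=> x; exact: energy_density_ge0.
  - by move=> X; apply: part_le => x; rewrite lerDl energy_density_ge0.
  - by move=> x; exact: energy_density_ge0.
  - by move=> X; apply: part_le => x; rewrite lerDr energy_density_ge0.
have N1 : N u v <= 1.
  by rewrite -tsum_e//; apply: tsum_le_bound => //; exact: summable_e.
exists u, v; split=> // xi eta adx Nx; apply: le_trans (leS _ _ adx Nx) _.
(* One half of [d] pays for the distance to the supremum, the other for the tail outside [X]; the
   finite sum over [X] converges along [F]. *)
apply/ler_addgt0Pr => d d0; have d2 : 0 < d / 2 by rewrite divr_gt0.
have [X [finX tailX]] := interaction_tail d2.
rewrite -lerBlDr; apply: (@le_trans _ _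
  (\sum_(x \in X) mu x * (`|u x| `^ al * `|v x| `^ be))).
  rewrite fsbig_finite//.
  apply: (@cvgr_to_ge _ F _ _ (fun p =>
    \sum_(x <- fset_set X) mu x * (`|p.1 x| `^ al * `|p.2 x| `^ be))).
    apply: cvg_big => [|x _]; first exact: add_continuous.
    apply: cvgM; first exact: cvg_cst.
    apply: cvgM.
      apply: (@cvg_comp _ _ _ (fun p => p.1 x) (fun r => `|r| `^ al) F _ _ (pu x)).
      exact: continuous_abs_powR.
    apply: (@cvg_comp _ _ _ (fun p => p.2 x) (fun r => `|r| `^ be) F _ _ (pv x)).
    exact: continuous_abs_powR.
  apply: filterS (Ftop _ d2) => p [[pa pb] Sp]; rewrite -fsbig_finite//.
  by have := tailX _ _ pa pb; lra.
apply: fsum_le_tsum => //; last exact: abs_summable_admissible.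
by move=> x; exact: interaction_density_ge0.
Qed.

End MaximalInteraction.

(** * Extremal pairs and the Euler-Lagrange equation *)

Section EulerLagrange.
Context {R : realType} {V : choiceType} (w : V -> V -> R) (mu : V -> R).
Variables (mu_min al be : R) (ca cb : V -> R).
Hypotheses (w_ge0 : forall x y, 0 <= w x y) (w_fin : locally_finite w).
Hypotheses (mu_min_gt0 : 0 < mu_min) (mu_ge : forall x, mu_min <= mu x).
Hypotheses (al_gt1 : 1 < al) (be_gt1 : 1 < be).
Hypotheses (ca_ge1 : forall x, 1 <= ca x) (cb_ge1 : forall x, 1 <= cb x).

Let mu_gt0 x : 0 < mu x. Proof. exact: lt_le_trans (mu_ge x). Qed.

(** Only the first component varies. Along [u + s * xi], the tangent bound for the interaction and
    the extremal inequality give [1 + s * l <= (1 + 2 * s * c + s ^+ 2 * d) ^ q], and comparing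
    slopes yields the equation. Exchanging the two components gives the other one. *)
Lemma euler_lagrange (u v xi : V -> R) (n : R) : 0 < n ->
  admissible w mu ca cb u v -> finite_energy w mu ca xi ->
  pair_energy w mu ca cb u v = n -> interaction mu al be u v = n ->
  (forall z, finite_energy w mu ca z -> interaction mu al be z v <=
     n * (pair_energy w mu ca cb z v / n) `^ ((al + be) / 2)) ->
  energy w mu ca u xi = al / (al + be) *
    tsum (fun x => mu x * (`|u x| `^ (al - 2) * u x * `|v x| `^ be * xi x)).
Proof.
move=> n0 [Eu Ev] Exi Nn Bn ext; set T := tsum _.
have ab0 : 0 < al + be by rewrite addr_gt0 ?(lt_trans ltr01).
have Euxi s := finite_energyD w_ge0 w_fin mu_gt0 ca_ge1 s Eu Exi.
have NE s : pair_energy w mu ca cb (fun x => u x + s * xi x) v / n =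
    1 + 2 * s * (energy w mu ca u xi / n) + s ^+ 2 * (energy w mu ca xi xi / n).
  rewrite /pair_energy (energy_quad w_ge0 w_fin mu_gt0 ca_ge1)//.
  have {1}-> : energy w mu ca u u = n - energy w mu cb v v.
    by rewrite -Nn /pair_energy; ring.
  by field; rewrite gt_eqF.
have q1 : 1 < (al + be) / 2 by move: al_gt1 be_gt1; lra.
have : al * T / n = 2 * ((al + be) / 2) * (energy w mu ca u xi / n).
  apply: (@powR_quadratic_tangent _ _ _ _ (energy w mu ca xi xi / n) q1) => s.
    rewrite -NE divr_ge0 ?(ltW n0)//.
    by apply: (pair_energy_ge0 w_ge0 w_fin mu_min_gt0 mu_ge ca_ge1 cb_ge1) => //; split.
  rewrite -NE -(ler_pM2l n0); apply: le_trans (ext _ (Euxi s)).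
  have [K [uK vK]] := admissible_bounded w_ge0 w_fin
    mu_min_gt0 mu_ge ca_ge1 cb_ge1 (conj Eu Ev).
  have [L [xiL _]] := admissible_bounded w_ge0 w_fin
    mu_min_gt0 mu_ge ca_ge1 ca_ge1 (conj Exi Exi).
  have sq z c : (forall x, 1 <= c x) -> finite_energy w mu c z -> square_summable mu z.
    by move=> c1; exact: abs_summable_sqr.
  have := @interaction_tangent _ _ mu mu_gt0 al be (Num.max K L) u v xi s al_gt1 be_gt1.
  rewrite Bn => tan; apply: le_trans (tan _ _ _ _ _ _ _).
  - by rewrite le_eqVlt -/T; apply/orP; left; apply/eqP; field; rewrite gt_eqF.
  - by move=> x; rewrite le_max uK.
  - by move=> x; rewrite le_max vK.
  - by move=> x; rewrite le_max xiL orbT.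
  - exact: sq Eu.
  - exact: sq Ev.
  - exact: sq Exi.
  - exact: sq (Euxi s).
rewrite [2 * _]mulrC divfK// mulrA => /divIf E.
rewrite mulrAC E ?gt_eqF//.
by rewrite mulrAC mulfV ?mul1r// gt_eqF.
Qed.

End EulerLagrange.

(** * Scaling the maximizer to an extremal pair *)

Section ExtremalPair.
Context {R : realType} {V : choiceType} (w : V -> V -> R) (mu : V -> R).
Variables (mu_min al be : R) (ca cb : V -> R).
Hypotheses (w_sym : forall x y, w x y = w y x) (w_ge0 : forall x y, 0 <= w x y).
Hypothesis w_fin : locally_finite w.
Hypotheses (mu_min_gt0 : 0 < mu_min) (mu_ge : forall x, mu_min <= mu x).
Hypotheses (al_gt1 : 1 < al) (be_gt1 : 1 < be).
Hypotheses (ca_ge1 : forall x, 1 <= ca x) (cb_ge1 : forall x, 1 <= cb x).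
Hypothesis coercive : forall M : R, exists X : set V, finite_set X /\
  forall x, ~ X x -> M <= ca x /\ M <= cb x.
Implicit Types u v xi eta : V -> R.

Let mu_gt0 x : 0 < mu x. Proof. exact: lt_le_trans (mu_ge x). Qed.

Local Notation B := (interaction mu al be).
Local Notation N := (pair_energy w mu ca cb).
Local Notation adm := (admissible w mu ca cb).

Lemma pair_energy_eq0 u v : adm u v -> N u v <= 0 -> u = (fun=> 0) /\ v = (fun=> 0).
Proof.
move=> [Eu Ev] N0.
have Nu := energy_ge0 w_ge0 w_fin mu_gt0 ca_ge1 Eu.
have Nv := energy_ge0 w_ge0 w_fin mu_gt0 cb_ge1 Ev; rewrite /pair_energy in N0.
suff z c (f : V -> R) : (forall x, 1 <= c x) -> finite_energy w mu c f ->
    energy w mu c f f <= 0 -> f = (fun=> 0).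
  by split; [apply: z Eu _ => //|apply: z Ev _ => //]; lra.
move=> c1 Ef f0; apply/funext => x.
have := le_trans (sqr_le_energy w_ge0 w_fin mu_gt0 c1 x Ef) f0.
rewrite pmulr_rle0// => fx; apply/eqP; rewrite -sqrf_eq0 eq_le fx.
exact: sqr_ge0.
Qed.

Lemma admissibleZ u v t : adm u v -> adm (fun x => t * u x) (fun x => t * v x).
Proof. by move=> [Eu Ev]; split; exact: finite_energyZ. Qed.

Lemma pair_energyZ u v t : adm u v ->
  N (fun x => t * u x) (fun x => t * v x) = t ^+ 2 * N u v.
Proof. by move=> [Eu Ev]; rewrite /pair_energy !energyZ// mulrDr. Qed.

Lemma admissible_interactionZ u v t : 0 <= t -> adm u v ->
  B (fun x => t * u x) (fun x => t * v x) = t `^ (al + be) * B u v.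
Proof.
move=> t0 uv.
have [K [uK vK]] := admissible_bounded w_ge0 w_fin mu_min_gt0 mu_ge ca_ge1 cb_ge1 uv.
have [su sv] := admissible_sqr w_ge0 w_fin mu_min_gt0 mu_ge ca_ge1 cb_ge1 uv.
exact: (@interactionZ _ _ _ mu_gt0 _ _ K).
Qed.

(** A small multiple of the indicator of [x0] lies in the unit ball, and its interaction is positive
    because of the term at [x0]. *)
Lemma interaction_max_gt0 u v (x0 : V) :
  (forall xi eta, adm xi eta -> N xi eta <= 1 -> B xi eta <= B u v) -> 0 < B u v.
Proof.
move=> ext; pose d : V -> R := fun x => (x == x0)%:R.
have ad : adm d d by split; exact: finite_energy_indicator.
have N0 : 0 <= N d d.
  by exact: (pair_energy_ge0 w_ge0 w_fin mu_min_gt0 mu_ge ca_ge1 cb_ge1) ad.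
(* This choice gives [t ^+ 2 * N d d <= 1] without a square root. *)
pose t := (1 + N d d)^-1; have t0 : 0 < t by rewrite invr_gt0; lra.
have Nt : N (fun x => t * d x) (fun x => t * d x) <= 1.
  rewrite pair_energyZ// /t exprVn mulrC ler_pdivrMr ?exprn_gt0; nra.
apply: lt_le_trans (ext _ _ (admissibleZ t ad) Nt).
rewrite admissible_interactionZ// ?(ltW t0)// mulr_gt0 ?powR_gt0//.
apply: (@lt_le_trans _ _ (mu x0 * (`|d x0| `^ al * `|d x0| `^ be))).
  by rewrite /d eqxx normr1 !powR1 !mulr1.
apply: (@term_le_tsum _ _ (fun x => mu x * (`|d x| `^ al * `|d x| `^ be))).
  by move=> x; exact: interaction_density_ge0.
exact: (abs_summable_admissible w_ge0 w_fin mu_min_gt0 mu_ge _ _ ca_ge1 cb_ge1).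
Qed.

(** Rescaling by [N ^ (- 1/2)] puts the pair on the unit sphere and divides the interaction by
    [N ^ ((al + be) / 2)]. A pair with [N = 0] is zero, and both sides vanish. *)
Lemma interaction_le_scaled S xi eta :
  (forall xi eta, adm xi eta -> N xi eta <= 1 -> B xi eta <= S) ->
  adm xi eta -> B xi eta <= S * N xi eta `^ ((al + be) / 2).
Proof.
move=> ext ad; have q0 : (al + be) / 2 != 0 by rewrite gt_eqF//; move: al_gt1 be_gt1; lra.
have [N0|N0] := leP (N xi eta) 0.
  have -> : N xi eta = 0.
    apply/eqP; rewrite eq_le N0/=.
    exact: (pair_energy_ge0 w_ge0 w_fin mu_min_gt0 mu_ge ca_ge1 cb_ge1) ad.
  have [-> ->] := pair_energy_eq0 ad N0.
  rewrite powR0// mulr0 /interaction.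
  rewrite (_ : (fun x : V => _) = fun=> 0) ?tsum0//; apply/funext => x.
  by rewrite normr0 powR0 ?mul0r ?mulr0// gt_eqF// (lt_trans ltr01).
set m := N xi eta in N0 *; pose t := m `^ (- 2^-1).
have t0 : 0 <= t by exact: powR_ge0.
have t2 : t ^+ 2 * m = 1.
  rewrite -powR_mulrn// -powRrM mulNr mulVf// powRN powRr1 ?ltW//.
  by rewrite mulVf// gt_eqF.
have := ext _ _ (admissibleZ t ad); rewrite pair_energyZ// -/m t2 => /(_ (lexx _)).
rewrite admissible_interactionZ// /t -powRrM.
have -> : - 2^-1 * (al + be) = - ((al + be) / 2) by ring.
by rewrite powRN mulrC ler_pdivrMr// powR_gt0.
Qed.

Lemma extremal_pair (x0 : V) : exists u v (n : R), [/\ 0 < n, adm u v,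
  N u v = n, B u v = n & forall xi eta, adm xi eta ->
    B xi eta <= n * (N xi eta / n) `^ ((al + be) / 2)].
Proof.
have [u [v [ad N1 ext]]] := interaction_max w_ge0 w_fin mu_min_gt0 mu_ge
   al_gt1 be_gt1 ca_ge1 cb_ge1 coercive.
have S0 := interaction_max_gt0 x0 ext.
have scaled xi eta := interaction_le_scaled (xi := xi) (eta := eta) ext.
set S := B u v in S0 ext scaled.
(* A maximizer inside the ball would give [S <= S * N ^ q < S]. *)
have NE : N u v = 1.
  apply/eqP; rewrite eq_le N1/= leNgt; apply/negP => Nlt1.
  have Sle := scaled _ _ ad; rewrite -/S in Sle.
  have : N u v `^ ((al + be) / 2) < 1.
    have {2}-> : 1 = 1 `^ ((al + be) / 2) :> R by rewrite powR1.
    rewrite gt0_ltr_powR ?nnegrE//; first by move: al_gt1 be_gt1; lra.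
    exact: (pair_energy_ge0 w_ge0 w_fin mu_min_gt0 mu_ge ca_ge1 cb_ge1) ad.
  by rewrite ltNge -(ler_pM2l S0) mulr1 Sle.
(* Solves [t ^ (al + be) * S = t ^+ 2], which equates the interaction and the energy of
   [(t * u, t * v)] since [N u v = 1]. *)
pose t := S `^ (- (al + be - 2)^-1).
have t0 : 0 < t by rewrite powR_gt0.
have tp : t `^ (al + be) * S = t ^+ 2.
  have -> : al + be = (al + be - 2) + 2 by ring.
  rewrite powRD; last by rewrite (gt_eqF t0) implybT.
  rewrite -powRrM mulNr mulVf; last by rewrite gt_eqF//; move: al_gt1 be_gt1; lra.
  rewrite powRN powRr1 ?(ltW S0)// mulrAC mulVf ?gt_eqF// mul1r.
  by rewrite (powR_mulrn 2)// ltW.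
exists (fun x => t * u x), (fun x => t * v x), (t ^+ 2); split.
- by rewrite exprn_gt0.
- exact: admissibleZ.
- by rewrite pair_energyZ// NE mulr1.
- by rewrite admissible_interactionZ// ?(ltW t0).
move=> xi eta adx; apply: le_trans (scaled _ _ adx) _.
have Nx : 0 <= N xi eta.
  by exact: (pair_energy_ge0 w_ge0 w_fin mu_min_gt0 mu_ge ca_ge1 cb_ge1) adx.
have t20 : 0 < t ^+ 2 by rewrite exprn_gt0.
(* With [n = t ^+ 2] the choice of [t] reads [n ^ q * S = n], which turns the bound [S * N ^ q] into
   [n * (N / n) ^ q]. *)
have tE : t `^ (al + be) = (t ^+ 2) `^ ((al + be) / 2).
  by rewrite -(powR_mulrn 2 (ltW t0)) -powRrM mulrC divfK.
rewrite tE in tp.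
rewrite -[X in _ <= X * _]tp.
rewrite mulrAC -powRM ?(ltW t20) ?divr_ge0 ?(ltW t20)//.
by rewrite [leLHS]mulrC ler_pM2r// mulrCA mulfV ?mulr1 ?gt_eqF.
Qed.

End ExtremalPair.

(** * Ground states *)

Section NehariFunctional.
Context {R : realType} {V : choiceType} (w : V -> V -> R) (mu : V -> R).
Variables (mu_min alpha beta lambda : R) (a b : V -> R).
Hypothesis w_ge0 : forall x y, 0 <= w x y.
Hypothesis w_fin : locally_finite w.
Hypotheses (mu_min_gt0 : 0 < mu_min) (mu_ge : forall x, mu_min <= mu x).
Hypotheses (al_gt1 : 1 < alpha) (be_gt1 : 1 < beta).
Hypotheses (a_ge0 : forall x, 0 <= a x) (b_ge0 : forall x, 0 <= b x).
Hypothesis lambda_gt0 : 0 < lambda.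
Implicit Types u v xi eta : V -> R.

Let mu_gt0 x : 0 < mu x. Proof. exact: lt_le_trans (mu_ge x). Qed.

Let ca x := lambda * a x + 1.
Let cb x := lambda * b x + 1.
Let ca_ge1 x : 1 <= ca x. Proof. by rewrite lerDr mulr_ge0// ltW. Qed.
Let cb_ge1 x : 1 <= cb x. Proof. by rewrite lerDr mulr_ge0// ltW. Qed.

Local Notation adm := (admissible w mu ca cb).
Local Notation N := (pair_energy w mu ca cb).
Local Notation B := (interaction mu alpha beta).

Lemma nnintE (f : V -> R) : (forall x, 0 <= f x) ->
  (nnint mu f < +oo)%E <-> abs_summable (fun x => mu x * f x).
Proof.
move=> f0; rewrite /nnint /abs_summable.
suff -> : (\esum_(x in [set: V]) (mu x * f x)%:E =
           \esum_(x in [set: V]) `|mu x * f x|%:E)%E by [].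
by apply: eq_esum => x _; rewrite ger0_norm// mulr_ge0// ltW.
Qed.

(** The energy density of each component is its Sobolev density plus its potential term; all are
    nonnegative, so finiteness of the sums can be compared termwise. *)
Lemma inHlamE u v : inHlam w mu a b lambda u v <-> adm u v.
Proof.
have W_ge0 f x : 0 <= Gam w mu f f x + f x ^+ 2.
  by rewrite addr_ge0 ?sqr_ge0 ?Gam_ge0.
have P_ge0 x : 0 <= lambda * a x * u x ^+ 2 + lambda * b x * v x ^+ 2.
  by rewrite addr_ge0// mulr_ge0 ?sqr_ge0// mulr_ge0// ltW.
have la x : 0 <= lambda * a x * u x ^+ 2 by rewrite mulr_ge0 ?sqr_ge0// mulr_ge0// ltW.
have lb x : 0 <= lambda * b x * v x ^+ 2 by rewrite mulr_ge0 ?sqr_ge0// mulr_ge0// ltW.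
have qE c f x : energy_density w mu (fun x => c x + 1) f f x =
    mu x * (Gam w mu f f x + f x ^+ 2) + mu x * (c x * f x ^+ 2).
  by rewrite /energy_density; ring.
have qa x : energy_density w mu ca u u x = _ := qE (fun x => lambda * a x) u x.
have qb x : energy_density w mu cb v v x = _ := qE (fun x => lambda * b x) v x.
have W0 f x : 0 <= mu x * (Gam w mu f f x + f x ^+ 2) by rewrite mulr_ge0// ltW.
have ma x : 0 <= mu x * (lambda * a x * u x ^+ 2) by rewrite mulr_ge0// ltW.
have mb x : 0 <= mu x * (lambda * b x * v x ^+ 2) by rewrite mulr_ge0// ltW.
split.
  move=> [/(nnintE (W_ge0 u)) Wu [/(nnintE (W_ge0 v)) Wv /(nnintE P_ge0) P]]; split.
    apply: abs_summable_le (abs_summableD Wu P) => x.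
    rewrite ger0_norm; last exact: energy_density_ge0.
    by rewrite qa lerD2l mulrDr lerDl.
  apply: abs_summable_le (abs_summableD Wv P) => x.
  rewrite ger0_norm; last exact: energy_density_ge0.
  by rewrite qb lerD2l mulrDr lerDr.
move=> [Eu Ev]; split; [|split].
- apply/(nnintE (W_ge0 u)); apply: abs_summable_le Eu => x.
  by rewrite ger0_norm// qa lerDl.
- apply/(nnintE (W_ge0 v)); apply: abs_summable_le Ev => x.
  by rewrite ger0_norm// qb lerDl.
- apply/(nnintE P_ge0); apply: abs_summable_le (abs_summableD Eu Ev) => x.
  rewrite mulrDr ger0_norm; last by rewrite addr_ge0.
  by rewrite qa qb lerD// lerDr.
Qed.

Lemma ipHlamE u v xi eta : adm u v -> adm xi eta ->
  ipHlam w mu a b lambda u v xi eta = energy w mu ca u xi + energy w mu cb v eta.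
Proof.
move=> [Eu Ev] [Exi Eeta]; rewrite /energy -tsumD.
- by congr tsum; apply/funext => x; rewrite /energy_density /ca /cb; ring.
- exact: abs_summable_energy.
- exact: abs_summable_energy.
Qed.

(** The second sum is written with [v] first, so that it is the first one with components and
    exponents exchanged. *)
Lemma dJlamE u v xi eta : adm u v -> adm xi eta ->
  dJlam w mu a b lambda alpha beta u v xi eta =
  energy w mu ca u xi + energy w mu cb v eta
  - (alpha / (alpha + beta) *
       tsum (fun x => mu x * (`|u x| `^ (alpha - 2) * u x * `|v x| `^ beta * xi x))
     + beta / (alpha + beta) *
       tsum (fun x => mu x * (`|v x| `^ (beta - 2) * v x * `|u x| `^ alpha * eta x))).
Proof.
move=> uv xieta; rewrite /dJlam ipHlamE//; congr (_ - _).
have [K [uK vK]] := admissible_bounded w_ge0 w_fin mu_min_gt0 mu_ge ca_ge1 cb_ge1 uv.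
have [su sv] := admissible_sqr w_ge0 w_fin mu_min_gt0 mu_ge ca_ge1 cb_ge1 uv.
have [sxi seta] := admissible_sqr w_ge0 w_fin mu_min_gt0 mu_ge ca_ge1 cb_ge1 xieta.
have s1 := abs_summable_interaction_deriv mu_gt0 al_gt1 be_gt1 uK vK sv sxi.
have s2 := abs_summable_interaction_deriv mu_gt0 be_gt1 al_gt1 vK uK su seta.
rewrite -!tsumZ// -tsumD; do ?exact: abs_summableZ.
by congr tsum; apply/funext => x; ring.
Qed.

(** On the diagonal both derivative terms become [B u v], and their weights add up to 1. *)
Lemma dJlam_diag u v : adm u v ->
  dJlam w mu a b lambda alpha beta u v u v = N u v - B u v.
Proof.
move=> uv; rewrite dJlamE//; congr (_ - _).
have pow2 al (r : R) : 1 < al -> `|r| `^ (al - 2) * r * r = `|r| `^ al.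
  move=> al1; have [->|r0] := eqVneq r 0.
    by rewrite mulr0 normr0 powR0// gt_eqF// (lt_trans ltr01).
  rewrite -mulrA -expr2 -(real_normK (num_real r)) -powR_mulrn//.
  rewrite -powRD; last by rewrite normr_eq0 r0 implybT.
  by rewrite subrK.
have -> : tsum (fun x => mu x * (`|u x| `^ (alpha - 2) * u x * `|v x| `^ beta * u x)) = B u v.
  by congr tsum; apply/funext => x; rewrite [_ * u x]mulrAC pow2.
have -> : tsum (fun x => mu x * (`|v x| `^ (beta - 2) * v x * `|u x| `^ alpha * v x)) = B u v.
  by rewrite interactionC; congr tsum; apply/funext => x; rewrite [_ * v x]mulrAC pow2.
by rewrite -mulrDl -mulrDl mulfV ?mul1r// gt_eqF// addr_gt0// (lt_trans ltr01).
Qed.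

Lemma JlamE u v : adm u v ->
  Jlam w mu a b lambda alpha beta u v = N u v / 2 - (alpha + beta)^-1 * B u v.
Proof. by move=> uv; rewrite /Jlam ipHlamE. Qed.

Lemma Nehari_pair_energy u v : Nehari w mu a b lambda alpha beta u v ->
  [/\ adm u v, 0 < N u v & B u v = N u v].
Proof.
move=> [/inHlamE uv [uv0 dJ]]; split=> //.
  rewrite ltNge; apply/negP => N0; apply: uv0.
  exact: (pair_energy_eq0 w_ge0 w_fin mu_min_gt0 mu_ge ca_ge1 cb_ge1 uv N0).
by move: dJ; rewrite dJlam_diag// => /eqP; rewrite subr_eq0 => /eqP.
Qed.

Lemma extremal_ground_state u v n : 0 < n -> adm u v -> N u v = n -> B u v = n ->
  (forall xi eta, adm xi eta ->
    B xi eta <= n * (N xi eta / n) `^ ((alpha + beta) / 2)) ->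
  weak_solution w mu a b lambda alpha beta u v /\
  Nehari w mu a b lambda alpha beta u v /\
  (Jlam w mu a b lambda alpha beta u v)%:E = cNehari w mu a b lambda alpha beta.
Proof.
move=> n0 uv Nn Bn ext; have [Eu Ev] := uv.
have Neh : Nehari w mu a b lambda alpha beta u v.
  split; first exact/inHlamE.
  split; last by rewrite dJlam_diag// Nn Bn subrr.
  move=> [u0 v0]; suff : N u v = 0 by rewrite Nn => /eqP; rewrite gt_eqF.
  have := pair_energyZ w_fin 0 uv; rewrite expr0n mul0r => <-.
  by rewrite u0 v0; congr pair_energy; apply/funext => x; rewrite mul0r.
split; [split; first exact/inHlamE|split=> //].
  move=> xi eta /inHlamE xieta; have [Exi Eeta] := xieta.
  rewrite dJlamE//.
  rewrite (euler_lagrange w_ge0 w_fin mu_min_gt0 mu_ge al_gt1 be_gt1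
    ca_ge1 cb_ge1 n0 uv Exi Nn Bn); last by move=> z Ez; exact: ext.
  have NC z y : pair_energy w mu cb ca y z = N z y by rewrite /pair_energy addrC.
  (* The second equation is the first for the pair [(v, u)], with exponents and coefficients
     exchanged. *)
  rewrite (@euler_lagrange _ _ w mu mu_min beta alpha cb ca w_ge0 w_fin mu_min_gt0
    mu_ge be_gt1 al_gt1 cb_ge1 ca_ge1 v u eta n n0 (conj Ev Eu) Eeta).
  - by rewrite [beta + alpha]addrC subrr.
  - by rewrite NC.
  - by rewrite interactionC.
  - by move=> z Ez; rewrite NC interactionC [beta + alpha]addrC; exact: ext.
have ab2 : 0 < 2^-1 - (alpha + beta)^-1.
  by rewrite subr_gt0 ltf_pV2 ?posrE//; move: al_gt1 be_gt1; lra.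
(* Where [B = N], the functional is a positive multiple of [N], so it remains to show [n <= N] on
   the Nehari manifold. *)
have JE xi eta : adm xi eta -> B xi eta = N xi eta ->
    Jlam w mu a b lambda alpha beta xi eta = (2^-1 - (alpha + beta)^-1) * N xi eta.
  by move=> ad BN; rewrite JlamE// BN; ring.
apply/eqP; rewrite eq_le; apply/andP; split; last first.
  by apply: ereal_inf_lbound; exists (u, v).
apply: le_ereal_inf_tmp => _ [[xi eta] /= /Nehari_pair_energy[ad m0 BN] <-].
rewrite lee_fin !JE//; last by rewrite Nn.
rewrite ler_pM2l// Nn; have := ext _ _ ad; rewrite BN.
(* For [r = m / n] the extremal inequality reads [r <= r ^ q]. Since [q > 1], this excludes
   [0 < r < 1]. *)
set m := N xi eta in m0 *; rewrite -ler_pdivrMl// mulrC => rle.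
rewrite leNgt; apply/negP => mn.
have r0 : 0 < m / n by rewrite divr_gt0.
have r1 : m / n < 1 by rewrite ltr_pdivrMr// mul1r.
move: rle; rewrite -[leRHS]mulr_powRB1 ?(ltW r0)//; last first.
  by move: al_gt1 be_gt1; lra.
rewrite ler_pMr// leNgt => /negP; apply.
suff : (m / n) `^ ((alpha + beta) / 2 - 1) < 1 `^ ((alpha + beta) / 2 - 1).
  by rewrite powR1.
rewrite gt0_ltr_powR ?nnegrE ?(ltW r0)//.
by move: al_gt1 be_gt1; lra.
Qed.

End NehariFunctional.

Unset Implicit Arguments.

Theorem theorem1p1 (R : realType) (V : choiceType) (w : V -> V -> R)
  (mu : V -> R) (mu_min : R) (alpha beta : R) (a b : V -> R) :
  (forall x y, w x y = w y x) -> (forall x y, 0 <= w x y) ->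
  locally_finite w -> connected_graph w ->
  0 < mu_min -> (forall x, mu_min <= mu x) ->
  1 < alpha -> 1 < beta ->
  A1 w a b -> A2 w a b ->
  forall lambda : R, 0 < lambda ->
  exists u v : V -> R,
    weak_solution w mu a b lambda alpha beta u v /\
    Nehari w mu a b lambda alpha beta u v /\
    (Jlam w mu a b lambda alpha beta u v)%:E = cNehari w mu a b lambda alpha beta.
Proof.
move=> w_sym w_ge0 w_fin _ mu_min_gt0 mu_ge al_gt1 be_gt1.
move=> [a_ge0 [b_ge0 _]] [x0 a2] lambda lambda_gt0.
have ge1 c : (forall x, 0 <= c x) -> forall x : V, 1 <= lambda * c x + 1.
  by move=> c0 x; rewrite lerDr mulr_ge0// ltW.
have coercive M : exists X : set V, finite_set X /\ forall x, ~ X x ->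
    M <= lambda * a x + 1 /\ M <= lambda * b x + 1.
  (* Outside a ball around [x0], which is finite, [a] and [b] exceed [M / lambda], hence
     [lambda * a + 1] and [lambda * b + 1] exceed [M]. *)
  have [m am] := a2 (M / lambda).
  exists [set x | dist_le w x x0 m]; split; first exact: finite_ball.
  move=> x /am[]; rewrite !ler_pdivrMr// ![_ * lambda]mulrC => Ma Mb.
  by split; [rewrite (le_trans Ma)|rewrite (le_trans Mb)]; rewrite ?lerDl.
have [u [v [n [n0 uv Nn Bn ext]]]] := extremal_pair w_sym w_ge0 w_fin
  mu_min_gt0 mu_ge al_gt1 be_gt1 (ge1 a a_ge0) (ge1 b b_ge0) coercive x0.
exists u, v; exact: (extremal_ground_state w_ge0 w_fin mu_min_gt0 mu_ge
  al_gt1 be_gt1 a_ge0 b_ge0 lambda_gt0 n0 uv Nn Bn ext).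
Qed.
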